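(* Let $w\in W_C$. If there exist $x\in\mathfrak g_C$ and a type C Hessenberg space $H_C\subseteq\mathfrak g_C$ such that $\mathcal B_C(x,H_C)=X^C_{w^{-1}}$, then $w$, viewed as a permutation in $S_{2n}$, avoids the pattern $[4231]$. (Equivalently, since $[4231]$ is its own inverse: if $\mathcal B_C(x,H_C)=X^C_w$ then $w$ avoids $[4231]$.)
   Context: Let $J$ be the $n\times n$ antidiagonal matrix of $1$'s, $E=\begin{bmatrix}0&J\\-J&0\end{bmatrix}$, and $\sigma(A)=E(A^{\mathsf{tr}})^{-1}E^{-1}$ on $SL_{2n}(\mathbb C)$ with differential $\sigma(x)=Ex^{\mathsf{tr}}E$. $G_C=SL_{2n}(\mathbb C)^\sigma\cong Sp_{2n}(\mathbb C)$, $\mathfrak g_C=\mathfrak{sl}_{2n}(\mathbb C)^\sigma\cong\mathfrak{sp}_{2n}(\mathbb C)$, $B$ the upper triangular matrices in $SL_{2n}(\mathbb C)$, $B_C=B^\sigma$ (a Borel subgroup of $G_C$) with Lie algebra $\mathfrak b_C$. The Weyl group of $G_C$ is identified with $W_C=\{w\in S_{2n}: w(2n+1-i)=2n+1-w(i)\ \forall i\}$; $\dot w\in N_{G_C}(T^\sigma)$ is a representative ($T$ the diagonal torus). $X^C_w$ is the closure of $B_C\dot wB_C/B_C$ in $G_C/B_C$. A type C Hessenberg space is a subspace $H_C\subseteq\mathfrak g_C$ with $[\mathfrak b_C,H_C]\subseteq H_C$; $\mathcal B_C(x,H_C)=\{gB_C: g^{-1}xg\in H_C\}$. A permutation $w\in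 S_N$ contains the pattern $v\in S_m$ if there are indices $i_1<\dots<i_m$ with $w(i_a)<w(i_b)\iff v(a)<v(b)$ for all $a,b$; otherwise it avoids $v$. *)

(* Defs.v *)
From HB Require Import structures.
From mathcomp Require Import all_boot all_order all_algebra all_fingroup.
From mathcomp Require Import reals complex.
Set Implicit Arguments. Unset Strict Implicit. Unset Printing Implicit Defensive.
Import Order.TTheory GRing.Theory Num.Theory.
Local Open Scope ring_scope.

Section TypeC.
Variables (R : realType) (n : nat).
Local Notation C := (R[i]).
Local Notation N := (n + n)%N.
Local Notation M := 'M[C]_N.

Definition Jmx : 'M[C]_n := \matrix_(i < n, j < n) (if (i + j == n.-1)%N then 1 else 0).

Definition Emx : M := block_mx 0 Jmx (- Jmx) 0.

Definition sigma_grp (A : M) : M := Emx *m invmx A^T *m invmx Emx.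
(* differential sigma(x) = E x^T E *)
Definition sigma_lie (x : M) : M := Emx *m x^T *m Emx.

Definition in_SL (A : M) : Prop := \det A = 1.
Definition in_GC (A : M) : Prop := in_SL A /\ sigma_grp A = A.
Definition in_gC (x : M) : Prop := \tr x = 0 /\ sigma_lie x = x.

Definition upper_tri (A : M) : Prop := forall i j : 'I_N, (j < i)%N -> A i j = 0.
Definition in_BC (A : M) : Prop := in_SL A /\ upper_tri A /\ sigma_grp A = A.
(* b_C = Lie algebra of B_C = upper triangular elements of g_C *)
Definition in_bC (y : M) : Prop := in_gC y /\ upper_tri y.

Definition hessenbergC (H : {vspace M}) : Prop :=
  (forall h, h \in H -> in_gC h) /\
  (forall y h, in_bC y -> h \in H -> y *m h - h *m y \in H).

(* preimage in G_C of the Hessenberg variety B_C(x, H_C) \subseteq G_C / B_C *)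
Definition hessC_pre (x : M) (H : {vspace M}) (g : M) : Prop :=
  in_GC g /\ invmx g *m x *m g \in H.

(* W_C = { w in S_{2n} : w(2n+1-i) = 2n+1-w(i) } (0-based: rev_ord) *)
Definition in_WC (w : 'S_N) : Prop := forall i : 'I_N, w (rev_ord i) = rev_ord (w i).

(* representatives of w in N_{G_C}(T^sigma): elements of G_C that are monomial
   matrices with pattern w, i.e. g e_j \in C^* e_{w(j)} *)
Definition rep_of (w : 'S_N) (g : M) : Prop :=
  in_GC g /\ forall i j : 'I_N, (g i j != 0) = (i == w j).

(* B_C \dot w B_C (as a subset of G_C); independent of the representative *)
Definition cellC (w : 'S_N) (g : M) : Prop :=
  exists b1 wd b2, in_BC b1 /\ rep_of w wd /\ in_BC b2 /\ g = b1 *m wd *m b2.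

Definition mx_closure (S : M -> Prop) (g : M) : Prop :=
  forall e : C, 0 < e -> exists s, S s /\ forall i j : 'I_N, `|g i j - s i j| < e.

(* preimage in G_C of the Schubert variety X^C_w \subseteq G_C / B_C *)
Definition schubC_pre (w : 'S_N) (g : M) : Prop := mx_closure (cellC w) g.

End TypeC.

Definition contains_pattern (N : nat) (w : 'S_N) (v : seq nat) : Prop :=
  exists f : 'I_(size v) -> 'I_N,
    (forall a b : 'I_(size v), (a < b)%N -> (f a < f b)%N) /\
    (forall a b : 'I_(size v), (w (f a) < w (f b))%N = (nth 0%N v a < nth 0%N v b)%N).

Definition avoids_pattern (N : nat) (w : 'S_N) (v : seq nat) : Prop :=
  ~ contains_pattern w v.

(* Main.v *)
Require Import Defs.
From HB Require Import structures.
From mathcomp Require Import all_boot all_order all_algebra all_fingroup.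
From mathcomp Require Import reals complex.
From mathcomp Require Import ring zify.
Set Implicit Arguments. Unset Strict Implicit. Unset Printing Implicit Defensive.
Import Order.TTheory GRing.Theory Num.Theory.
Local Open Scope ring_scope.

(** Let [u = w^-1], suppose that [u] has a [4231] at positions
    [i1 < i2 < i3 < i4], and let [v] be [u] times the type C reflection
    exchanging [i2] and [i3] (and their mirror images).  This reflection creates
    an inversion, so [v] is not below [u] in Bruhat order and no representative
    of [v] lies in the closure of [B_C u B_C]; concretely, a corner rank of [v]
    exceeds that of [u], and the rank is lower semicontinuous.

    On the other hand let [I] be the set of [y] in [g_C] with [g^-1 y g] in [H]
    for all [g] in the Schubert variety; it contains [x] and is a [B_C]-module
    because the Schubert variety is [B_C]-stable.  The supports of [I] and [H],
    viewed as sets of matrix positions, are closed under moving up and to the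
    right.  The extreme entries of the pattern and of its mirror image
    dominate all the points moved by the reflection, so every root of [I] is sent
    by [v^-1] into [H] because [u^-1] sends some higher root of [I] to a lower
    root of [H].  The diagonal parts of [v^-1 x v] and [u^-1 x u] differ by a
    multiple of a coroot, which lies in [H] for the same reason.  Hence
    [v^-1 x v] is in [H], and [v] is in the Schubert variety after all. *)

Lemma addrr_neq0 (F : numDomainType) (z : F) : z != 0 -> z + z != 0.
Proof. by rewrite -mulr2n mulrn_eq0. Qed.

(** * Ranks of lower left corners *)

Section Rank.
Variables (F : fieldType) (N : nat).
Implicit Types (A B : 'M[F]_N).

Lemma rank_col_support A (K : {set 'I_N}) :
  (forall i j, A i j != 0 -> j \in K) -> (\rank A <= #|K|)%N.
Proof.
move=> hA.
have -> : A = \sum_(k in K) A *m delta_mx k k.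
  apply/matrixP=> i j; rewrite summxE.
  have dE k : (A *m delta_mx k k) i j = A i k *+ (j == k).
    rewrite mxE (bigD1 k) //= big1 => [|l lk]; rewrite mxE ?(negPf lk) ?mulr0 //.
    by rewrite eqxx mulr_natr addr0.
  have [jK|jK] := boolP (j \in K).
    rewrite (bigD1 j) //= big1 => [|k /andP[_ kj]]; rewrite dE ?eqxx ?addr0 //.
    by rewrite eq_sym (negPf kj).
  have -> : A i j = 0 by apply/eqP; apply: contraNT jK => /hA.
  rewrite big1 // => k kK; rewrite dE.
  by case: eqVneq kK jK => [->->|].
rewrite -sum1_card; elim/big_rec2: _ => [|k m B _ IH]; first by rewrite mxrank0.
apply: leq_trans (mxrank_add _ _) _; rewrite leq_add //.
by apply: leq_trans (mxrankM_maxr _ _) _; rewrite mxrank_delta.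
Qed.

(** The block of rows from [l] on and columns up to [k], padded with zeros so that it keeps size [N]
    and can be subtracted from and added to full matrices. *)
Definition corner (k l : nat) A : 'M[F]_N :=
  \matrix_(i, j) if (l <= i)%N && (j <= k)%N then A i j else 0.

(** Rows from [l] on of [b1 *m A] involve only rows from [l] on of [A], and dually for columns up to
    [k]. So the corner of the product is a product with the corner of [A] as a factor. *)
Lemma rank_corner_mul (k l : nat) (b1 A b2 : 'M[F]_N) :
  (forall i j : 'I_N, (j < i)%N -> b1 i j = 0) ->
  (forall i j : 'I_N, (j < i)%N -> b2 i j = 0) ->
  (\rank (corner k l (b1 *m A *m b2)) <= \rank (corner k l A))%N.
Proof.
move=> t1 t2.
pose L : 'M[F]_N := diag_mx (\row_i (l <= i)%:R).
pose Q : 'M[F]_N := diag_mx (\row_i (i <= k)%:R).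
have cE B : corner k l B = L *m B *m Q.
  apply/matrixP=> i j; rewrite mul_mx_diag mul_diag_mx !mxE.
  by case: ifP => [/andP[-> ->]|/negbT]; rewrite ?mul1r ?mulr1 // negb_and => /orP[]/negPf->;
    rewrite ?mul0r ?mulr0.
have LE : L *m b1 = L *m b1 *m L.
  apply/matrixP=> i j; rewrite mul_mx_diag mul_diag_mx !mxE.
  case: (leqP l i) => li; last by rewrite !mul0r.
  by case: (leqP l j) => lj; rewrite ?mulr1 // t1 ?(leq_trans lj) // !mulr0.
have QE : b2 *m Q = Q *m b2 *m Q.
  apply/matrixP=> i j; rewrite !mul_mx_diag mul_diag_mx !mxE.
  case: (leqP j k) => jk; last by rewrite !mulr0.
  case: (leqP i k) => ik; rewrite ?mul1r // t2 ?mulr0 //; exact: leq_ltn_trans jk ik.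
rewrite !cE -!mulmxA QE !mulmxA LE -!mulmxA.
apply: leq_trans (mxrankM_maxr _ _) _; apply: leq_trans (mxrankM_maxr _ _) _.
rewrite !mulmxA; apply: leq_trans (mxrankM_maxl _ _) _.
exact: mxrankM_maxl.
Qed.

End Rank.

(** * Corner ranks of permutations *)

Section CornerSet.
Variable N : nat.
Implicit Types u : 'S_N.

(** With the convention that column [a] has its entry in row [u a], the cardinal of this set is the
    corner rank of a monomial matrix of pattern [u]. *)
Definition corner_set (k l : nat) u := [set a : 'I_N | (a <= k)%N && (l <= u a)%N].

Lemma corner_set_tperm (k l : nat) u (i j : 'I_N) :
  (i < j)%N -> (u i < u j)%N ->
  (#|corner_set k l u| + ((i <= k < j) && (u i < l <= u j))
     <= #|corner_set k l (tperm i j * u)%g|)%N.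
Proof.
move=> ij uij.
have cE u' : #|corner_set k l u'| = (((i <= k) && (l <= u' i)) + ((j <= k) && (l <= u' j))
   + \sum_(a | (a != i) && (a != j)) ((a <= k) && (l <= u' a)))%N.
  rewrite -sum1_card (eq_bigl (fun a : 'I_N => (a <= k) && (l <= u' a))%N) => [|a]; last by rewrite inE.
  rewrite big_mkcond (bigD1 i) //= (bigD1 j) /=; last by case: eqVneq ij => // ->; rewrite ltnn.
  rewrite addnA; congr (_ + _)%N; by apply: eq_bigr => a _; case: ifP.
rewrite !cE !permM tpermL tpermR.
rewrite [X in (_ <= _ + X)%N](eq_bigr (fun a : 'I_N => nat_of_bool ((a <= k)%N && (l <= u a)%N))); last first.
  by move=> a /andP[ai aj]; rewrite permM tpermD // eq_sym.
set S := bigop _ _ _; rewrite addnAC leq_add2r.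
case: (leqP i k); case: (leqP j k); case: (leqP l (u i)); case: (leqP l (u j)) => /=; lia.
Qed.

End CornerSet.

(** If [v *m B = 0] with [v] nonzero, then [v = v *m ((A - B) *m invmx A)]. For [B] close to [A]
    this map strictly shrinks the l1 norm, which is absurd. *)
Lemma det_neq0_open (F : numFieldType) (N : nat) (A : 'M[F]_N) :
  \det A != 0 ->
  exists2 d : F, 0 < d & forall B : 'M[F]_N,
    (forall i j, `|A i j - B i j| < d) -> \det B != 0.
Proof.
move=> dA; have uA : A \in unitmx by rewrite unitmxE unitfE.
pose K := \sum_k \sum_m `|invmx A m k|.
have K0 : 0 <= K by apply: sumr_ge0 => k _; apply: sumr_ge0.
have K1 : 0 < K + 1 by rewrite ltr_wpDl.
exists (K + 1)^-1 => [|B hB]; first by rewrite invr_gt0.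
apply/det0P=> -[v v0 vB].
have vE : v = v *m ((A - B) *m invmx A).
  by rewrite mulmxA mulmxBr vB subr0 -mulmxA mulmxV // mulmx1.
pose nv := \sum_l `|v 0 l|.
have nv0 : 0 < nv.
  rewrite lt0r sumr_ge0 // andbT; apply: contra v0 => /eqP nv0.
  apply/eqP/rowP=> l; rewrite mxE; apply/eqP; rewrite -normr_eq0 eq_le normr_ge0 andbT -nv0.
  by rewrite /nv (bigD1 l) //= lerDl sumr_ge0.
suff : nv <= nv * ((K + 1)^-1 * K).
  by rewrite ler_pMr // ler_pdivlMl // mulr1 gerDl ler10.
have rowT l : \sum_k `|((A - B) *m invmx A) l k| <= (K + 1)^-1 * K.
  rewrite mulr_sumr; apply: ler_sum => k _; rewrite mxE mulr_sumr.
  apply: le_trans (ler_norm_sum _ _ _) _; apply: ler_sum => m _.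
  by rewrite normrM !mxE ler_wpM2r // ltW.
rewrite {1}/nv {1}vE; under eq_bigr do rewrite mxE.
apply: (@le_trans _ _ (\sum_k \sum_l `|v 0 l * ((A - B) *m invmx A) l k|)).
  by apply: ler_sum => k _; apply: ler_norm_sum.
rewrite exchange_big /nv mulr_suml; apply: ler_sum => l _.
under eq_bigr do rewrite normrM.
by rewrite -mulr_sumr ler_wpM2l.
Qed.

(** [H] is stable under entrywise multiplication by any polynomial in [c]; the indicator of the
    value [l] is obtained by Lagrange interpolation at the finitely many values of [c]. *)
Lemma hadamard_indicator (F : fieldType) (N : nat) (H : {vspace 'M[F]_N})
    (c : 'I_N -> 'I_N -> F) (l : F) :
  (forall y, y \in H -> \matrix_(i, j) (c i j * y i j) \in H) ->
  forall y, y \in H -> \matrix_(i, j) (y i j *+ (c i j == l)) \in H.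
Proof.
move=> Hc y yH.
have Hp (p : {poly F}) : \matrix_(i, j) (p.[c i j] * y i j) \in H.
  elim/poly_ind: p => [|p k IH].
    by rewrite (_ : \matrix_(i, j) _ = 0) ?mem0v //; apply/matrixP=> i j; rewrite !mxE horner0 mul0r.
  rewrite (_ : \matrix_(i, j) _ =
    \matrix_(i, j) (c i j * (\matrix_(i, j) (p.[c i j] * y i j)) i j) + k *: y).
    by rewrite memvD ?memvZ ?Hc.
  by apply/matrixP=> i j; rewrite !mxE hornerMXaddC; ring.
pose p := \prod_(ij : 'I_N * 'I_N | c ij.1 ij.2 != l)
  ((l - c ij.1 ij.2)^-1 *: ('X - (c ij.1 ij.2)%:P)).
rewrite (_ : \matrix_(i, j) _ = \matrix_(i, j) (p.[c i j] * y i j)) //.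
apply/matrixP=> i j; rewrite !mxE /p horner_prod; case: (eqVneq (c i j) l) => [->|cl].
  rewrite big1 ?mul1r // => ij ijl; rewrite hornerZ hornerXsubC mulVf //.
  by rewrite subr_eq0 eq_sym.
by rewrite (bigD1 (i, j)) //= hornerZ hornerXsubC subrr mulr0 !mul0r.
Qed.

(** * The symplectic group and its Lie algebra in coordinates *)

Section Symplectic.
Variables (R : realType) (n : nat).
Local Notation C := (R[i]).
Local Notation N := (n + n)%N.
Local Notation M := 'M[C]_N.
Local Notation E := (Emx R n).
Local Notation star := (@rev_ord N).

Definition eps (i : 'I_N) : C := if (i < n)%N then 1 else -1.

Lemma eps_rev i : eps (star i) = - eps i.
Proof.
rewrite /eps /=; case: (ltnP i n) => h; case: ltnP => h'; rewrite ?opprK //; exfalso; have := ltn_ord i; lia.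
Qed.

Lemma eps_sq i : eps i * eps i = 1.
Proof. by rewrite /eps; case: ifP; rewrite ?mulrNN mulr1. Qed.

Lemma rev_neq (i : 'I_N) : star i != i.
Proof. by apply/eqP=> /(congr1 val) /=; have := ltn_ord i; lia. Qed.

Lemma EmxE i j : E i j = eps i *+ (j == star i).
Proof.
rewrite /Emx /block_mx !mxE /eps -val_eqE /=.
case: splitP => i' Ei; rewrite !mxE; case: splitP => j' Ej; rewrite !mxE Ei Ej.
- by have := ltn_ord i'; have := ltn_ord j'; case: eqP => //; lia.
- have := ltn_ord i'; have := ltn_ord j' => h1 h2.
  have -> : (n + j' == n + n - i'.+1)%N = (i' + j' == n.-1)%N by lia.
  by case: ifP.
- have := ltn_ord i'; have := ltn_ord j' => h1 h2.
  have -> : (j' == n + n - (n + i').+1 :> nat)%N = (i' + j' == n.-1)%N by lia.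
  by case: ifP; rewrite ?oppr0.
- have := ltn_ord i'; have := ltn_ord j' => h1 h2.
  have -> : (n + j' == n + n - (n + i').+1 :> nat)%N = false by lia.
  by [].
Qed.

Lemma mulEmx (A : M) i j : (E *m A) i j = eps i * A (star i) j.
Proof.
rewrite mxE (bigD1 (star i)) //= big1 => [|k ki]; rewrite EmxE ?(negPf ki) ?mul0r //.
by rewrite eqxx addr0.
Qed.

Lemma mulmxE (A : M) i j : (A *m E) i j = - eps j * A i (star j).
Proof.
rewrite mxE (bigD1 (star j)) //= big1 => [|k ki]; rewrite EmxE.
  by rewrite rev_ordK eqxx addr0 eps_rev mulrC.
by rewrite -(inj_eq rev_ord_inj) rev_ordK eq_sym (negPf ki) mulr0.
Qed.

Lemma Emx_sq : E *m E = - 1%:M.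
Proof.
apply/matrixP=> i j; rewrite mulEmx EmxE rev_ordK !mxE eq_sym eps_rev.
by case: eqP; rewrite ?mulr0n ?mulr0 ?oppr0 // mulr1n mulrN eps_sq.
Qed.

Lemma Emx_unit : E \in unitmx.
Proof. by case: (@mulmx1_unit _ _ E (- E)); rewrite // mulmxN Emx_sq opprK. Qed.

Lemma sigma_lieE (y : M) i j :
  sigma_lie y i j = - (eps i * eps j) * y (star j) (star i).
Proof. by rewrite /sigma_lie mulmxE mulEmx mxE mulrA; congr (_ * _); ring. Qed.

(** The trace condition is automatic: the entrywise relation pairs opposite diagonal entries, whence
    [\tr y = - \tr y]. *)
Lemma in_gCP (y : M) :
  in_gC y <-> forall i j, y i j = - (eps i * eps j) * y (star j) (star i).
Proof.
split=> [[_ /matrixP h] i j|h]; first by rewrite -h sigma_lieE.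
split; last by apply/matrixP=> i j; rewrite sigma_lieE.
have : \tr y = - \tr y.
  rewrite {1}/mxtrace (reindex_inj rev_ord_inj) -sumrN; apply: eq_bigr => i _.
  by rewrite h !rev_ordK eps_rev mulrNN eps_sq mulN1r.
by move/eqP; rewrite -addr_eq0 -mulr2n mulrn_eq0 => /eqP.
Qed.

Lemma in_gC_commE (y : M) : in_gC y -> y *m E = - (E *m y^T).
Proof. by case=> _ h; rewrite -{1}h /sigma_lie -mulmxA Emx_sq mulmxN mulmx1. Qed.

Lemma in_GCP (A : M) : in_GC A <-> \det A = 1 /\ A *m E *m A^T = E.
Proof.
split=> -[dA h]; split=> //.
  have uA : A^T \in unitmx by rewrite unitmx_tr unitmxE dA unitr1.
  by rewrite -{1}h /sigma_grp mulmxKV ?Emx_unit // mulmxKV.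
have uA : A^T \in unitmx by rewrite unitmx_tr unitmxE dA unitr1.
by rewrite /sigma_grp -{1}h mulmxK // mulmxK ?Emx_unit.
Qed.

Lemma in_GC_unit (A : M) : in_GC A -> A \in unitmx.
Proof. by case=> dA _; rewrite unitmxE dA unitr1. Qed.

Lemma in_GC_mul (A B : M) : in_GC A -> in_GC B -> in_GC (A *m B).
Proof.
move=> /in_GCP[dA hA] /in_GCP[dB hB]; apply/in_GCP; split.
  by rewrite det_mulmx dA dB mulr1.
by rewrite trmx_mul !mulmxA -(mulmxA A) -(mulmxA A) hB.
Qed.

Lemma in_BC_mul (A B : M) : in_BC A -> in_BC B -> in_BC (A *m B).
Proof.
move=> [dA [tA hA]] [dB [tB hB]].
have [d h] := in_GC_mul (conj dA hA) (conj dB hB); split=> //; split=> // i j ji.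
rewrite mxE big1 // => k _; have [ki|ik] := ltnP k i; first by rewrite tA ?mul0r.
by rewrite tB ?mulr0 // (leq_trans ji).
Qed.

Lemma in_gC_conj (g y : M) : in_GC g -> in_gC y -> in_gC (invmx g *m y *m g).
Proof.
move=> hg hy; have ug := in_GC_unit hg; have /in_GCP[_ gE] := hg.
have ugT : g^T \in unitmx by rewrite unitmx_tr.
set z := _ *m g; have zE : z *m E = - (E *m z^T).
  apply: (can_inj (mulKmx ug)); apply: (can_inj (mulmxK ugT)).
  rewrite /z !mulmxA mulmxV // mul1mx -!mulmxA (mulmxA g) gE in_gC_commE //.
  rewrite !trmx_mul !(mulmxN, mulNmx) !mulmxA gE trmx_inv; congr (- _).
  by rewrite -!mulmxA mulVmx // mulmx1.
clearbody z; apply/in_gCP=> i j.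
have := congr1 (fun X : M => X i (star j)) zE.
rewrite mulmxE [RHS]mxE mulEmx [z^T _ _]mxE rev_ordK eps_rev opprK => h.
by rewrite -[LHS]mul1r -(eps_sq j) -mulrA h; ring.
Qed.

(** Since [X] squares to zero, [1%:M + X] is its exponential. In the expansion of
    [(1 + X) E (1 + X)^T] the linear terms cancel and the quadratic one is a multiple of
    [(X *m X)^T]. *)
Lemma unipotent_in_BC (X : M) : in_gC X -> X *m X = 0 ->
  (forall i j : 'I_N, (j <= i)%N -> X i j = 0) -> in_BC (1%:M + X).
Proof.
move=> gX XX tX.
have [d h] : in_GC (1%:M + X).
  apply/in_GCP; split.
    rewrite -det_tr det_trig; last first.
      apply/is_trig_mxP=> i j ij; rewrite !mxE tX ?(ltnW ij) // addr0.
      by case: eqP ij => // ->; rewrite ltnn.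
    by rewrite big1 // => i _; rewrite !mxE tX // addr0 eqxx.
  rewrite linearD /= trmx1 mulmxDl mul1mx mulmxDr mulmx1 mulmxDl (in_gC_commE gX).
  by rewrite mulNmx -mulmxA -trmx_mul XX trmx0 mulmx0 oppr0 addr0 subrK.
split=> //; split=> // i j ji; rewrite !mxE tX ?(ltnW ji) // addr0.
by case: eqP ji => // ->; rewrite ltnn.
Qed.

Lemma rep_conjE (u : 'S_N) (g y : M) i j : rep_of u g ->
  (invmx g *m y *m g) i j = y (u i) (u j) * g (u j) j / g (u i) i.
Proof.
move=> [hg gu]; have ug := in_GC_unit hg.
have gui k : g (u k) k != 0 by rewrite gu.
apply: (canRL (mulfK (gui i))).
set z := _ *m g; have gz : g *m z = y *m g by rewrite /z !mulmxA mulmxV // mul1mx.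
clearbody z; have := congr1 (fun X : M => X (u i) j) gz; rewrite !mxE.
rewrite (bigD1 i) //= [X in _ + X]big1 => [|k ki]; last first.
  suff -> : g (u i) k = 0 by rewrite mul0r.
  by apply/eqP; rewrite -[_ == _]negbK gu (inj_eq perm_inj) eq_sym.
rewrite (bigD1 (u j)) //= [X in _ = _ + X]big1 => [|k ki]; last first.
  suff -> : g k j = 0 by rewrite mulr0.
  by apply/eqP; rewrite -[_ == _]negbK gu.
by rewrite !addr0 mulrC => ->.
Qed.

(** * Bruhat cells and their closures *)

Lemma cell_rank (u : 'S_N) (g : M) (k l : nat) :
  cellC u g -> (\rank (corner k l g) <= #|corner_set k l u|)%N.
Proof.
move=> [b1 [wd [b2 [[_ [t1 _]] [[_ hw] [[_ [t2 _]] ->]]]]]].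
apply: leq_trans (rank_corner_mul _ _ _ t1 t2) _.
apply: rank_col_support => i j; rewrite mxE inE.
by case: ifP => [/andP[li ->]|]; rewrite ?eqxx // hw => /eqP <-.
Qed.

Lemma rep_notin_schub (u v : 'S_N) (g : M) (k l : nat) :
  rep_of v g -> (#|corner_set k l u| < #|corner_set k l v|)%N -> ~ schubC_pre u g.
Proof.
move=> [hg gv] uv gX.
have [|d d0 hd] := @det_neq0_open _ _ g; first by case: hg => -> _; rewrite oner_eq0.
have [s [sX gs]] := gX d d0.
(* Replacing the corner of [g] by that of [s] drops the rank, although the
   determinant is close to that of [g]. *)
pose B := g - corner k l g + corner k l s.
have /eqP [] : \det B != 0.
  apply: hd => i j; rewrite !mxE; case: ifP => _; last by rewrite subr0 addr0 subrr normr0.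
  by rewrite subrr add0r.
apply/eqP; rewrite -[_ == _]negbK -unitfE -unitmxE -row_free_unit -row_leq_rank -ltnNge.
apply: leq_ltn_trans (mxrank_add _ _) _.
have rs := cell_rank k l sX.
(* Each column of [g] has one nonzero entry, so removing the corner kills the columns in
   [corner_set k l v]. The two ranks then sum to less than [N]. *)
have rg : (\rank (g - corner k l g)%R <= #|~: corner_set k l v|)%N.
  apply: rank_col_support => i j; rewrite !mxE !inE.
  case: ifP => [|/negbT h]; first by rewrite subrr eqxx.
  by rewrite subr0 gv => /eqP iv; rewrite -iv andbC.
have := cardsC (corner_set k l v); rewrite card_ord; lia.
Qed.

Lemma schub_mulBC (u : 'S_N) (b g : M) :
  in_BC b -> schubC_pre u g -> schubC_pre u (b *m g).
Proof.
move=> hb gX e e0.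
(* A Lipschitz constant for left multiplication by [b]; the summand 1 makes it positive and the
   final estimate strict. *)
pose K := 1 + \sum_i \sum_j `|b i j|.
have S0 : 0 <= \sum_i \sum_j `|b i j| by apply: sumr_ge0 => i _; apply: sumr_ge0.
have K0 : 0 < K by rewrite ltr_wpDr.
have [|s0 [[b1 [wd [b2 [h1 [hw [h2 ->]]]]]] gs]] := gX (e / K); first by rewrite divr_gt0.
exists (b *m (b1 *m wd *m b2)); split.
  by exists (b *m b1), wd, b2; rewrite !mulmxA; split; [exact: in_BC_mul|].
move=> i j; set s := b1 *m wd *m b2.
have -> : (b *m g) i j - (b *m s) i j = \sum_k b i k * (g k j - s k j).
  by rewrite !mxE -sumrB; apply: eq_bigr => k _; rewrite mulrBr.
apply: (@le_lt_trans _ _ ((\sum_k `|b i k|) * (e / K))).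
  rewrite mulr_suml; apply: le_trans (ler_norm_sum _ _ _) _; apply: ler_sum => k _.
  by rewrite normrM ler_wpM2l // ltW // gs.
rewrite mulrA ltr_pdivrMr // mulrC ltr_pM2l // /K addrC.
apply: (@le_lt_trans _ _ (\sum_i \sum_j `|b i j|)); last by rewrite ltrDl ltr01.
by rewrite [leRHS](bigD1 i) //= lerDl; apply: sumr_ge0 => l _; apply: sumr_ge0.
Qed.

Lemma in_BC1 : in_BC (1%:M : M).
Proof.
split; first exact: det1.
split; last by rewrite /sigma_grp trmx1 invmx1 mulmx1 mulmxV ?Emx_unit.
by move=> i j ji; rewrite mxE; case: eqP ji => // ->; rewrite ltnn.
Qed.

Lemma rep_in_schub (u : 'S_N) (g : M) : rep_of u g -> schubC_pre u g.
Proof.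
move=> hg e e0; exists g; split; last by move=> i j; rewrite subrr normr0.
by exists 1%:M, g, 1%:M; rewrite mul1mx mulmx1; split; [exact: in_BC1|split=> //; split=> //; exact: in_BC1].
Qed.

(** * Representatives of Weyl group elements *)

Lemma Jmx_sq : Jmx R n *m Jmx R n = 1%:M.
Proof.
have := Emx_sq; rewrite /Emx mulmx_block !mulmx0 !mul0mx !add0r addr0 mulmxN.
by rewrite scalar_mx_block opp_block_mx => /eq_block_mx[/oppr_inj].
Qed.

(* A real matrix commuting with the complex structure [E] has determinant
   [|det (A + i B)|^2], hence a nonnegative one. *)
Lemma det_orthogonal_symplectic (g : M) :
  (forall i j, (g i j)^* = g i j) -> g *m g^T = 1%:M -> g *m E = E *m g ->
  \det g = 1.
Proof.
move=> gr gg gE.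
pose A := ulsubmx g; pose B := ursubmx g; pose D := dlsubmx g; pose F := drsubmx g.
pose J := Jmx R n; have JJ : J *m J = 1%:M := Jmx_sq.
have gK : g = block_mx A B D F by rewrite submxK.
move: gE; rewrite {1 2}gK /Emx !mulmx_block !mulmx0 !mul0mx !add0r !addr0.
rewrite !mulmxN !mulNmx => /eq_block_mx[e1 e2 _ _].
(* Conjugation by [K] removes the reversal [J] from [E], so that commuting with [E] becomes the
   usual block form of a complex matrix [A + i B']. *)
pose K : M := block_mx 1%:M 0 0 J; pose B' := B *m J.
have KgK : K *m g *m K = block_mx A B' (- B') A.
  rewrite gK /K !mulmx_block !mulmx0 !mul0mx !mul1mx !mulmx1 !add0r !addr0.
  by rewrite -/J in e1 e2 *; rewrite -e1 -e2 -mulmxA JJ mulmx1.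
have dJ : \det J * \det J = 1 by rewrite -det_mulmx JJ det1.
(* [U] and [V] are mutually inverse and unipotent; conjugating by them makes the matrix block
   triangular with complex conjugate diagonal blocks. *)
pose U : M := block_mx 1%:M 'i%:M 0 1%:M; pose V : M := block_mx 1%:M (- 'i)%:M 0 1%:M.
have ii : 'i * 'i = -1 :> C by rewrite -expr2 sqrCi.
have UgV : U *m (K *m g *m K) *m V = block_mx (A - 'i *: B') 0 (- B') (A + 'i *: B').
  rewrite KgK /U /V !mulmx_block !mulmx0 !mul0mx !mul1mx !mulmx1 !add0r !addr0.
  rewrite !mul_scalar_mx !mul_mx_scalar !scalerN; congr block_mx.
  - rewrite scaleNr scalerBr scalerA ii scaleN1r opprK opprD.
    by rewrite addrACA [- _ + _]addrC addrACA subrr add0r addNr.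
  - by rewrite scaleNr opprK addrC.
have dg : \det g = \det (A - 'i *: B') * \det (A + 'i *: B').
  rewrite -(det_lblock _ (- B')) -UgV !det_mulmx /U /V !det_ublock !det1.
  by rewrite !mulr1 !mul1r mulrAC dJ mul1r.
have cj : \det (A - 'i *: B') = (\det (A + 'i *: B'))^*.
  rewrite -det_map_mx; congr (\det _); apply/matrixP=> i j; rewrite !mxE.
  rewrite rmorphD rmorphM /= conjCi gr mulNr; congr (_ - _ * _).
  rewrite rmorph_sum; apply: eq_bigr => k _; rewrite rmorphM !mxE /= gr.
  by case: ifP; rewrite ?rmorph1 ?rmorph0.
have d0 : 0 <= \det g by rewrite dg cj mulrC -normCK exprn_ge0.
have : \det g ^+ 2 == 1 by rewrite expr2 -{2}det_tr -det_mulmx gg det1.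
by rewrite sqrp_eq1 // => /eqP.
Qed.

Lemma rep_exists (u : 'S_N) : in_WC u -> exists g : M, rep_of u g.
Proof.
move=> hu.
(* The relation [g E g^T = E] asks exactly for [c j * c (star j) = eps j * eps (u j)]. The signs are
   free on the first half and then forced on the second. *)
pose c (j : 'I_N) : C := if (j < n)%N then 1 else eps j * eps (u j).
have cc j : c j * c j = 1 by rewrite /c; case: ifP; rewrite ?mulr1 // mulrACA !eps_sq mulr1.
have cs j : c j * c (star j) = eps j * eps (u j).
  have e : eps (star j) * eps (u (star j)) = eps j * eps (u j).
    by rewrite hu !eps_rev mulrNN.
  rewrite /c e; case: (ltnP j n) => h; case: ltnP => h'; rewrite ?mul1r ?mulr1 //;
    exfalso; move: h h' => /=; have := ltn_ord j; lia.
have c0 j : c j != 0 by apply/eqP=> h; move: (cc j) => /eqP; rewrite h mul0r eq_sym oner_eq0.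
pose g : M := \matrix_(i, j) (c j *+ (i == u j)).
have gl (A : M) a j : (g *m A) (u a) j = c a * A a j.
  rewrite mxE (bigD1 a) //= big1 => [|k ka]; rewrite mxE (inj_eq perm_inj).
    by rewrite eqxx addr0.
  by rewrite eq_sym (negPf ka) mul0r.
have gTr (A : M) i b : (A *m g^T) i (u b) = A i b * c b.
  rewrite mxE (bigD1 b) //= big1 => [|k kb]; rewrite !mxE (inj_eq perm_inj).
    by rewrite eqxx addr0.
  by rewrite eq_sym (negPf kb) mulr0.
have uE i : i = u (u^-1 i)%g by rewrite permKV.
have gEg : g *m E *m g^T = E.
  apply/matrixP=> i j; rewrite (uE i) (uE j); move: (_ i) (_ j) => a b.
  rewrite gTr gl !EmxE -hu (inj_eq perm_inj); case: eqP => [->|]; last by rewrite !mulr0n mulr0 mul0r.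
  by rewrite !mulr1n mulrAC cs mulrAC eps_sq mul1r.
have gg : g *m g^T = 1%:M.
  apply/matrixP=> i j; rewrite (uE i) (uE j); move: (_ i) (_ j) => a b.
  rewrite -{1}(mulmx1 g) gTr gl !mxE (inj_eq perm_inj); case: eqP => [->|]; last by rewrite mulr0 mul0r.
  by rewrite mulr1 cc.
have gE : g *m E = E *m g.
  by rewrite -{2}gEg -!mulmxA (mulmx1C gg) mulmx1.
exists g; split.
  apply/in_GCP; split=> //; apply: det_orthogonal_symplectic => // i j.
  rewrite mxE rmorphMn /=; congr (_ *+ _).
  rewrite /c /eps; do 3?case: ifP => _; by rewrite ?(rmorphM, rmorphN) ?rmorph1.
by move=> i j; rewrite mxE; case: (i == u j); rewrite ?mulr0n ?eqxx ?mulr1n ?c0.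
Qed.

(** * Root vectors and brackets with them *)

Definition rootv (a b : 'I_N) : M := delta_mx a b + sigma_lie (delta_mx a b).
Definition lie (x y : M) : M := x *m y - y *m x.

(** For [b = star a] (long roots) the two terms agree and [rootv a b] is twice a matrix unit, the
    source of the case splits and factors 2 below. For [a = b] it is a torus element. *)
Lemma rootv_delta a b :
  rootv a b = delta_mx a b - (eps a * eps b) *: delta_mx (star b) (star a).
Proof.
rewrite /rootv; congr (_ + _); apply/matrixP=> i j.
rewrite sigma_lieE !mxE !(can2_eq rev_ordK rev_ordK) andbC.
case: andP => [[/eqP-> /eqP->]|_]; last by rewrite !mulr0 oppr0.
by rewrite !eps_rev; ring.
Qed.

Lemma rootvE a b i j : rootv a b i j =
  ((i == a) && (j == b))%:R - eps a * eps b * ((i == star b) && (j == star a))%:R.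
Proof. by rewrite rootv_delta !mxE. Qed.

Lemma rootv_gC a b : in_gC (rootv a b).
Proof.
have rE k l : rootv a b k l = delta_mx a b k l + sigma_lie (delta_mx a b) k l by rewrite [LHS]mxE.
apply/in_gCP=> i j; rewrite !rE mulrDr !sigma_lieE !rev_ordK addrC.
congr (_ + _); rewrite mulrA !eps_rev !mulrNN mulrACA.
by rewrite [eps j * eps i]mulrC mulrACA !eps_sq !mulr1 mul1r.
Qed.

Lemma lieE p q (y : M) i j : lie (rootv p q) y i j =
  y q j *+ (i == p) - eps p * eps q * y (star p) j *+ (i == star q)
  - y i p *+ (j == q) + eps p * eps q * y i (star q) *+ (j == star p).
Proof.
have dl a b (z : M) : (delta_mx a b *m z) i j = z b j *+ (i == a).
  rewrite mxE (bigD1 b) //= big1 => [|k kb]; rewrite mxE ?(negPf kb) ?andbF ?mul0r //.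
  by rewrite eqxx andbT addr0 mulr_natl.
have dr a b (z : M) : (z *m delta_mx a b) i j = z i a *+ (j == b).
  rewrite mxE (bigD1 a) //= big1 => [|k kb]; rewrite mxE ?(negPf kb) ?mulr0 //.
  by rewrite eqxx addr0 mulr_natr.
have sub (z t : M) : (z - t) i j = z i j - t i j by rewrite !mxE.
have scl (c : C) (z : M) : (c *: z) i j = c * z i j by rewrite mxE.
rewrite /lie rootv_delta mulmxBl mulmxBr -scalemxAl -scalemxAr !(sub, scl, dl, dr).
by rewrite !mulrnAr opprB addrA addrAC.
Qed.

(** * Supports of subsets of the Lie algebra stable under positive root vectors *)

Section Support.
Variable P : M -> Prop.
Hypothesis P_gC : forall y, P y -> in_gC y.
Hypothesis P_lie : forall (p q : 'I_N) y, (p < q)%N -> P y -> P (lie (rootv p q) y).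

(** [P] is a mere predicate, so that the results apply both to membership in [H] and to the module
    [I] below. *)
Definition supp (a b : 'I_N) := exists2 y : M, P y & y a b != 0.

Lemma supp_rev a b : supp a b -> supp (star b) (star a).
Proof.
case=> y Py yab; exists y => //; have /in_gCP h := P_gC Py.
by move: yab; rewrite h mulf_eq0 negb_or => /andP[].
Qed.

(** Bracketing with [rootv a' a] carries the entry in row [a] to row [a']. When a mirror term meets
    the same position, it doubles the entry instead of cancelling it. *)
Lemma supp_up (a a' b : 'I_N) : supp a b -> (a' < a)%N -> a != b -> supp a' b.
Proof.
case=> y Py yab a'a ab; exists (lie (rootv a' a) y); first exact: P_lie.
have /in_gCP h := P_gC Py.
rewrite lieE eqxx (eq_sym b a) (negPf ab) subr0 mulr1n.
have [e|e] := eqVneq a' (star a).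
  have -> : (b == star a') = false by rewrite e rev_ordK eq_sym (negPf ab).
  rewrite addr0 mulr1n e rev_ordK eps_rev mulNr eps_sq mulN1r opprK.
  exact: addrr_neq0.
rewrite mulr0n subr0; have [eb|_] := eqVneq b (star a'); last by rewrite mulr0n addr0.
rewrite mulr1n (h a' (star a)) rev_ordK -eb mulrA eps_rev !mulrN opprK mulrACA !eps_sq.
by rewrite !mul1r addrr_neq0.
Qed.

Lemma supp_right (a b b' : 'I_N) : supp a b -> (b < b')%N -> a != b -> supp a b'.
Proof.
move=> /supp_rev s bb' ab; rewrite -[a]rev_ordK -[b']rev_ordK; apply: supp_rev.
apply: supp_up s _ _; last by rewrite (inj_eq rev_ord_inj) eq_sym.
by move=> /=; have := ltn_ord b'; lia.
Qed.

Lemma supp_diag (y : M) (a b : 'I_N) : P y -> (a < b)%N -> y a a != y b b -> supp a b.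
Proof.
move=> Py ab yab; exists (lie (rootv a b) y); first exact: P_lie.
rewrite lieE !eqxx !mulr1n; have d : y b b - y a a != 0 by rewrite subr_eq0 eq_sym.
have [e|e] := eqVneq a (star b).
  have sa : star a = b by rewrite e rev_ordK.
  have ee : eps a * eps b = -1 by rewrite e eps_rev mulNr eps_sq.
  rewrite sa -e eqxx !mulr1n ee !mulN1r opprK -addrA -opprD.
  by rewrite -!mulr2n -mulrnBl mulr2n addrr_neq0.
have -> : (b == star a) = false by rewrite eq_sym (can2_eq rev_ordK rev_ordK) (negPf e).
by rewrite subr0 addr0.
Qed.

(** This passes from a negative root to its opposite through the torus: a first bracket with
    [rootv b a] makes the diagonal entries at [a] and [b] differ, and [supp_diag] does the rest. *)
Lemma supp_opp (a b : 'I_N) : supp a b -> (b < a)%N -> supp b a.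
Proof.
case=> y Py yab ba; apply: (supp_diag (P_lie ba Py)) => //.
have nab : a == b = false by apply/negbTE/eqP=> e; move: ba; rewrite e ltnn.
have nas : a == star a = false by apply/negbTE; rewrite eq_sym rev_neq.
have nbs : b == star b = false by apply/negbTE; rewrite eq_sym rev_neq.
rewrite !lieE !eqxx [b == a]eq_sym nab nas nbs !mulr0n !mulr1n !subr0 !addr0 !sub0r ?add0r.
have [e|e] := eqVneq b (star a).
  have sb : star b = a by rewrite e rev_ordK.
  have ee : eps b * eps a = -1 by rewrite e eps_rev mulNr eps_sq.
  rewrite sb -e eqxx !mulr1n ee !mulN1r opprK -opprD -addr_eq0.
  by rewrite !addrr_neq0.
have -> : (a == star b) = false by rewrite eq_sym (can2_eq rev_ordK rev_ordK) (negPf e).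
by rewrite !mulr0n subr0 addr0 -addr_eq0 addrr_neq0.
Qed.

(** One moves up and right one direction at a time, in the order that avoids the diagonal. Both
    orders meet it only when [a' = b] and [b' = a], which is [supp_opp]. *)
Lemma supp_mono (a b a' b' : 'I_N) : supp a b -> a != b -> a' != b' ->
  (a' <= a)%N -> (b <= b')%N -> supp a' b'.
Proof.
move=> s ab ab' la lb.
have up (x y x' : 'I_N) : supp x y -> x != y -> (x' <= x)%N -> supp x' y.
  by move=> sxy xy; rewrite leq_eqVlt => /orP[/eqP/val_inj->|/supp_up]; [|apply].
have right (x y y' : 'I_N) : supp x y -> x != y -> (y <= y')%N -> supp x y'.
  by move=> sxy xy; rewrite leq_eqVlt => /orP[/eqP/val_inj<-|/supp_right]; [|apply].
have [e|ne] := eqVneq a' b; last by apply: right (up _ _ _ s ab la) _ lb.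
have [e'|ne'] := eqVneq a b'; last by apply: up (right _ _ _ s ab lb) _ la.
rewrite e -e'; apply: supp_opp s _.
by rewrite e leq_eqVlt in la; case/orP: la => // /eqP/val_inj h; rewrite h eqxx in ab.
Qed.

End Support.

Lemma rootv_bC (p q : 'I_N) : (p <= q)%N -> in_bC (rootv p q).
Proof.
move=> pq; split=> [|i j ji]; first exact: rootv_gC.
rewrite rootvE.
case: andP => [[/eqP ip /eqP jq]|_]; first by move: ji; rewrite ip jq ltnNge pq.
case: andP => [[/eqP ip /eqP jq]|_]; last by rewrite mulr0 subr0.
by move: ji; rewrite ip jq /=; have := ltn_ord q; lia.
Qed.

(** * Root decomposition of Hessenberg spaces *)

Section Hessenberg.

Variable H : {vspace M}.
Hypothesis hH : hessenbergC H.

Lemma hess_lie (p q : 'I_N) y : (p <= q)%N -> y \in H -> lie (rootv p q) y \in H.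
Proof. by move=> pq yH; case: hH => _; apply=> //; apply: rootv_bC. Qed.

(** The eigenvalue of the torus element [rootv k k] on the basis vector of index [i]. *)
Let wt (k i : 'I_N) : int := (i == k)%:Z - (i == star k)%:Z.

Lemma lie_torus k (y : M) i j : lie (rootv k k) y i j = (wt k i - wt k j)%:~R * y i j.
Proof.
rewrite lieE eps_sq !mul1r /wt !rmorphB /= -!pmulrn !mulrBl !mulr_natl.
have e (z : 'I_N -> C) (x x' : 'I_N) : z x' *+ (x == x') = z x *+ (x == x').
  by case: eqVneq => [->|].
rewrite (e (y^~ j)) (e (y^~ j)) (e (y i)) (e (y i)); ring.
Qed.

Lemma wtE k i : wt k i = if i == k then 1 else if i == star k then -1 else 0.
Proof.
rewrite /wt; have [->|ik] := eqVneq i k; last by case: eqP.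
by rewrite eq_sym (negPf (rev_neq k)).
Qed.

(* Differences of weights lie in [-2, 2], so the factor [5] lets [chi] determine
   both of them. *)
Let chi (a b i j : 'I_N) : int := 5 * (wt a i - wt a j) - (wt b i - wt b j).

(** The value at [(a, b)] is 12 if [b = star a], the maximum possible, and 6 otherwise. With
    differences in [-2, 2], [5 X - Y = 6] forces [X = 1] and [Y = -1]. *)
Lemma chi_sep (a b i j : 'I_N) : a != b -> chi a b i j = chi a b a b ->
  (i = a /\ j = b) \/ (i = star b /\ j = star a).
Proof.
move=> ab; have bd k x : (-1 <= wt k x <= 1)%R by rewrite wtE; do 2?case: ifP.
have w1 k x : wt k x = 1 -> x = k by rewrite wtE; case: eqP => // _; case: ifP.
have wN1 k x : wt k x = -1 -> x = star k by rewrite wtE; case: eqP => // _; case: eqP.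
have wkk k : wt k k = 1 by rewrite wtE eqxx.
rewrite /chi !wkk => e.
have := bd a i; have := bd a j; have := bd b i; have := bd b j; have := bd a b; have := bd b a.
have [bs|bs] := eqVneq b (star a).
  have wab : wt a b = -1 by rewrite wtE eq_sym (negPf ab) bs eqxx.
  have wba : wt b a = -1 by rewrite wtE (negPf ab) bs rev_ordK eqxx.
  rewrite wab wba in e * => *; left; split; first by apply: w1; lia.
  by rewrite bs; apply: wN1; lia.
have wab : wt a b = 0 by rewrite wtE eq_sym (negPf ab) (negPf bs).
have wba : wt b a = 0 by rewrite wtE (negPf ab) -(can2_eq rev_ordK rev_ordK) eq_sym (negPf bs).
rewrite wab wba in e * => *.
have [/w1 ia|/wN1 ja] : wt a i = 1 \/ wt a j = -1 by lia.
  by left; split=> //; rewrite ia wkk wba in e; apply: w1; lia.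
right; split=> //; apply: wN1.
have wbj : wt b j = 0.
  by rewrite wtE ja eq_sym (negPf bs) (inj_eq rev_ord_inj) (negPf ab).
have waj : wt a j = -1.
  by rewrite wtE ja eqxx (negPf (rev_neq _)).
rewrite wbj waj in e; lia.
Qed.

Lemma chiE (a b i j : 'I_N) : (chi a b i j)%:~R =
  5%:R * (wt a i - wt a j)%:~R - (wt b i - wt b j)%:~R :> C.
Proof.
rewrite /chi; move: (wt a i - wt a j) (wt b i - wt b j) => x y.
by rewrite intrB intrM.
Qed.

Lemma chi_rev (a b : 'I_N) : chi a b (star b) (star a) = chi a b a b.
Proof.
have wr k x : wt k (star x) = - wt k x.
  by rewrite /wt (inj_eq rev_ord_inj) -(can2_eq rev_ordK rev_ordK) opprB.
rewrite /chi !wr; ring.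
Qed.

(** The operator [5 ad(rootv a a) - ad(rootv b b)] preserves [H] and scales entries by [chi].
    Projecting to its eigenvalue at [(a, b)] leaves that entry and its mirror image, which is
    determined by it. *)
Lemma hess_rootv a b : supp (fun y => y \in H) a b -> a != b -> rootv a b \in H.
Proof.
case=> y yH yab ab.
have /in_gCP yC : in_gC y by case: hH => h _; apply: h.
have Hc z : z \in H -> \matrix_(i, j) ((chi a b i j)%:~R * z i j) \in H.
  move=> zH; rewrite (_ : \matrix_(i, j) _ = 5%:R *: lie (rootv a a) z - lie (rootv b b) z).
    by rewrite memvB ?memvZ ?hess_lie.
  apply/matrixP=> i j; rewrite [LHS]mxE chiE mulrBl -mulrA -!lie_torus.
  by move: (lie _ z) (lie _ z) => x t; rewrite !mxE.
have := hadamard_indicator (chi a b a b)%:~R Hc yH; set z := \matrix_(i, j) _ => zH.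
have s1 : (a == star b) = (b == star a) by rewrite eq_sym (can2_eq rev_ordK rev_ordK).
have s2 : (star b == a) = (b == star a) by rewrite eq_sym s1.
have s3 : (star a == b) = (b == star a) by rewrite eq_sym.
suff zE : (1 + (b == star a)%:R) *: z = y a b *: rootv a b.
  by rewrite -(scalerK yab (rootv a b)) -zE !memvZ.
apply/matrixP=> i j; rewrite [LHS]mxE [RHS]mxE rootvE [z i j]mxE eqr_int.
case: (chi a b i j =P chi a b a b) => [/(chi_sep ab)[[-> ->]|[-> ->]]|ne].
- rewrite !eqxx s1 andbb.
  have [->|] := eqVneq b; last by rewrite mulr0 addr0 subr0 mul1r mulr1.
  rewrite eps_rev mulrN eps_sq /=; ring.
- rewrite !eqxx s2 s3 andbb (yC _ (star a)) !rev_ordK !eps_rev mulrNN.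
  have [->|_] := eqVneq b (star a); last by rewrite ?mulr1n /=; ring.
  by rewrite !eps_rev !(mulNr, mulrN, opprK, eps_sq) /=; ring.
- rewrite mulr0n mulr0.
  case: andP => [[/eqP ia /eqP jb]|_]; first by case: ne; rewrite ia jb.
  case: andP => [[/eqP ia /eqP jb]|_]; first by case: ne; rewrite ia jb chi_rev.
  by rewrite mulr0 subrr mulr0.
Qed.

Definition diag_part (y : M) : M := \matrix_(i, j) (y i j *+ (i == j)).

(** Averaging the expansion in matrix units over [sigma_lie] replaces each unit by a root vector. *)
Lemma off_diag_mem (y : M) : in_gC y ->
  (forall a b, a != b -> y a b != 0 -> rootv a b \in H) -> y - diag_part y \in H.
Proof.
move=> /in_gCP yC hy; set O := y - _.
have OE i j : O i j = y i j *+ (i != j).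
  by rewrite !mxE; case: eqP; rewrite ?subrr ?subr0.
have sO : sigma_lie O = O.
  apply/matrixP=> i j; rewrite sigma_lieE !OE (inj_eq rev_ord_inj) eq_sym mulrnAr.
  by rewrite -yC.
have dE : O + O = \sum_a \sum_b O a b *: rootv a b.
  rewrite -{2}sO {1 2}(matrix_sum_delta O) /sigma_lie linear_sum mulmx_sumr mulmx_suml -big_split.
  apply: eq_bigr => a _; rewrite linear_sum mulmx_sumr mulmx_suml -big_split.
  apply: eq_bigr => b _; rewrite /= linearZ /= -scalemxAr -scalemxAl -scalerDr //.
have -> : O = 2%:R^-1 *: (O + O) by rewrite -[O + O]mulr2n -[O *+ 2]scaler_nat scalerK // pnatr_eq0.
rewrite dE memvZ //; apply: memv_suml => a _; apply: memv_suml => b _; rewrite OE.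
have [->|yab] := eqVneq (y a b) 0; first by rewrite mul0rn scale0r mem0v.
by have [|ab] := eqVneq a b; rewrite ?scale0r ?mem0v // memvZ ?hy.
Qed.

Lemma diag_part_mem (y : M) : y \in H -> diag_part y \in H.
Proof.
move=> yH; rewrite -[diag_part y](subKr y) memvB // off_diag_mem //.
  by case: hH => h _; apply: h.
by move=> a b ab yab; apply: hess_rootv => //; exists y.
Qed.

Lemma coroot_mem (a b : 'I_N) : (a < b)%N -> rootv b a \in H ->
  rootv a a - rootv b b \in H.
Proof.
move=> ab /(hess_lie (ltnW ab)).
suff -> : lie (rootv a b) (rootv b a) = (1 + (b == star a))%:R *: (rootv a a - rootv b b).
  have k0 : (1 + (b == star a))%:R != 0 :> C by rewrite pnatr_eq0.
  by move=> h; rewrite -(scalerK k0 (rootv a a - rootv b b)) memvZ.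
have sq : (eps a * eps b) * (eps b * eps a) = 1 by rewrite mulrACA [eps a * _]mulrC mulrACA !eps_sq mulr1.
rewrite /lie !rootv_delta !mulmxBl !mulmxBr -!scalemxAl -!scalemxAr !mul_delta_mx_cond !eqxx !scalerA.
rewrite sq [eps b * eps a * _]mulrC sq !eps_sq !scale1r.
rewrite [star a == b]eq_sym.
have -> : (star b == a) = (b == star a) by rewrite (can2_eq rev_ordK rev_ordK).
have -> : (a == star b) = (b == star a) by rewrite eq_sym (can2_eq rev_ordK rev_ordK).
have [bs|] := eqVneq b (star a).
  rewrite bs rev_ordK eps_rev mulrN mulNr eps_sq !mulr1n !scaleN1r !opprK scaler_nat mulr2n.
  apply/matrixP=> i j; rewrite !mxE; ring.
by rewrite !mulr0n !scaler0 !subr0 !sub0r !scale1r => _; apply/matrixP=> i j; rewrite !mxE; ring.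
Qed.

End Hessenberg.

(** If [b = star a] the two mirror transpositions coincide and their product would be trivial, hence
    the separate case. *)
Definition reflC (a b : 'I_N) : 'S_N :=
  if b == star a then tperm a b else (tperm (star b) (star a) * tperm a b)%g.

Lemma reflCE a b x : reflC a b x = if x == a then b else if x == b then a
  else if x == star a then star b else if x == star b then star a else x.
Proof.
have rK := @rev_ordK N; have ri := inj_eq (@rev_ord_inj N).
rewrite /reflC; have [->|bs] := eqVneq b (star a).
  rewrite permE /= rK; case: (x =P a) => // xa; case: (x =P star a) => // xs.
have /eqP ra := rev_neq a; have /eqP rb := rev_neq b; have ka := rK a; have kb := rK b.
move/eqP: bs => bs; rewrite permM !permE /=.
case: (x =P star b) => [->|xsb].
  by do 5?[case: eqP => //]; congruence.
case: (x =P star a) => [->|xsa].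
  by do 5?[case: eqP => //]; congruence.
by do 5?[case: eqP => //]; congruence.
Qed.

Lemma reflC_rev a b x : reflC a b (star x) = star (reflC a b x).
Proof.
have rK := @rev_ordK N; have ri := inj_eq (@rev_ord_inj N).
have /eqP ra := rev_neq a; have /eqP rb := rev_neq b; have ka := rK a; have kb := rK b.
rewrite !reflCE !(can2_eq rK rK) !rK.
case: (x =P a); case: (x =P b); case: (x =P star a); case: (x =P star b) => * //; congruence.
Qed.

(** At this corner the transposition of [a] and [b] gains one point, and the mirror transposition,
    which also creates an inversion, loses none. *)
Lemma reflC_corner (u : 'S_N) (a b : 'I_N) : in_WC u -> (a < b)%N -> (u a < u b)%N ->
  (#|corner_set a (u b) u| < #|corner_set a (u b) (reflC a b * u)%g|)%N.
Proof.
move=> hu ab uab.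
have := corner_set_tperm a (u b) ab uab; rewrite leqnn ab uab leqnn addn1 => lt1.
rewrite /reflC; case: eqVneq => // bs; apply: leq_trans lt1 _; rewrite -mulgA.
have tE x : x != star a -> x != star b -> (tperm a b * u)%g (star x) = star ((u x)).
  by move=> xa xb; rewrite permM tpermD ?hu // eq_sym (can2_eq (@rev_ordK _) (@rev_ordK _)).
have sab : star b != a by rewrite (can2_eq (@rev_ordK _) (@rev_ordK _)) // eq_sym.
apply: leq_trans (corner_set_tperm _ _ _ _); first exact: leq_addr.
  by move=> /=; have := ltn_ord b; lia.
rewrite !tE 1?[a == star _]eq_sym 1?[b == star b]eq_sym ?rev_neq //.
by move=> /=; have := ltn_ord (u b); lia.
Qed.

(** * The module [I] and the exclusion of the pattern *)

Section Main.

Lemma rootv_sq (p q : 'I_N) : p != q -> rootv p q *m rootv p q = 0.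
Proof.
move=> pq; rewrite rootv_delta mulmxBl !mulmxBr -!scalemxAl -!scalemxAr !mul_delta_mx_cond.
rewrite (inj_eq rev_ord_inj) [q == p]eq_sym [q == star q]eq_sym !(negPf (rev_neq _)) (negPf pq).
by rewrite !mulr0n !scaler0 !subr0.
Qed.

Lemma in_gC_scaleB (c : C) (y z : M) : in_gC y -> in_gC z -> in_gC (c *: (y - z)).
Proof.
move=> /in_gCP hy /in_gCP hz; apply/in_gCP=> i j.
by rewrite !mxE hy hz; ring.
Qed.

(** The terms [X y X] cancel. When [X] squares to zero the right side is a difference of two
    conjugates of [y], so stability under conjugation gives stability under brackets without taking
    limits. *)
Lemma lie_conj (X y : M) : lie X y + lie X y =
  (1%:M + X) *m y *m (1%:M - X) - (1%:M - X) *m y *m (1%:M + X).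
Proof.
rewrite /lie !mulmxDl !mul1mx !mulNmx !mulmxDr !mulmxN !mulmx1.
move: (X *m y *m X) (X *m y) (y *m X) => P Q S.
by apply/matrixP=> i j; rewrite !mxE; ring.
Qed.

Lemma rootv_BC (p q : 'I_N) (c : C) : (p < q)%N -> in_BC (1%:M + c *: rootv p q).
Proof.
move=> pq; have npq : p != q by apply: contraTneq pq => ->; rewrite ltnn.
apply: unipotent_in_BC.
- by rewrite -[rootv p q]subr0; apply: in_gC_scaleB; [exact: rootv_gC|];
    apply/in_gCP=> i j; rewrite !mxE mulr0.
- by rewrite -scalemxAl -scalemxAr rootv_sq // !scaler0.
- move=> i j; rewrite leq_eqVlt mxE => /orP[/eqP/val_inj->|ji].
    rewrite rootvE (_ : _ && _ = false); last first.
      by case: eqP => // ->; rewrite (negPf npq).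
    rewrite (_ : _ && _ = false) ?mulr0 ?subr0 ?mulr0 //.
    by case: eqP => // ->; rewrite (inj_eq rev_ord_inj) eq_sym (negPf npq).
  by have [_ h] := rootv_bC (ltnW pq); rewrite h ?mulr0.
Qed.

Variables (u : 'S_N) (x : M) (H : {vspace M}).
Hypotheses (hu : in_WC u) (gx : in_gC x) (hH : hessenbergC H).
Hypothesis hX : forall g, hessC_pre x H g <-> schubC_pre u g.

Let I (y : M) := in_gC y /\ forall g, schubC_pre u g -> invmx g *m y *m g \in H.

Lemma I_gC y : I y -> in_gC y. Proof. by case. Qed.

Lemma I_conj b y : in_BC b -> I y -> I (invmx b *m y *m b).
Proof.
move=> hb [gy hy]; have hbG : in_GC b by case: hb => d [_ h].
split=> [|g gX]; first exact: in_gC_conj.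
have /hy := schub_mulBC hb gX.
have /hX[gG _] := gX.
have -> : invmx (b *m g) = invmx g *m invmx b.
  have ug := in_GC_unit gG; have ub := in_GC_unit hbG.
  have ubg : b *m g \in unitmx by rewrite unitmx_mul ub.
  apply: (can_inj (mulKmx ubg)); rewrite mulmxV // -mulmxA (mulmxA g) mulmxV // mul1mx mulmxV //.
by rewrite !mulmxA.
Qed.

Lemma I_lie (p q : 'I_N) y : (p < q)%N -> I y -> I (lie (rootv p q) y).
Proof.
move=> pq Iy; have npq : p != q by apply: contraTneq pq => ->; rewrite ltnn.
set X := rootv p q; have XX : X *m X = 0 := rootv_sq npq.
have inv (c : C) : invmx (1%:M + c *: X) = 1%:M - c *: X.
  have uc : 1%:M + c *: X \in unitmx.
    by apply: in_GC_unit; case: (rootv_BC c pq) => d [_ h].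
  apply: (can_inj (mulKmx uc)); rewrite mulmxV // mulmxBr mulmx1 mulmxDl mul1mx.
  by rewrite -scalemxAl -scalemxAr XX !scaler0 addr0 addrK.
have [gp hp] : I ((1%:M - X) *m y *m (1%:M + X)).
  by have := I_conj (rootv_BC 1 pq) Iy; rewrite inv scale1r.
have [gm hm] : I ((1%:M + X) *m y *m (1%:M - X)).
  by have := I_conj (rootv_BC (-1) pq) Iy; rewrite inv scaleN1r opprK.
have -> : lie X y = 2%:R^-1 *: (lie X y + lie X y).
  by move: (lie X y) => L; rewrite -[L + L]mulr2n -[L *+ 2]scaler_nat scalerK // pnatr_eq0.
rewrite lie_conj; split=> [|g gX]; first exact: in_gC_scaleB.
by rewrite -scalemxAr -scalemxAl mulmxBr mulmxBl memvZ // memvB //; [exact: hm|exact: hp].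
Qed.

Lemma supp_rep (a b : 'I_N) : supp I (u a) (u b) -> supp (fun y => y \in H) a b.
Proof.
case=> y [gy hy] yab; have [g hg] := rep_exists hu.
exists (invmx g *m y *m g); first exact: hy (rep_in_schub hg).
by rewrite (rep_conjE _ _ _ hg) !mulf_neq0 ?invr_eq0 //; case: hg => _ ->.
Qed.

Lemma no_4231 (i1 i2 i3 i4 : 'I_N) : (i1 < i2)%N -> (i2 < i3)%N -> (i3 < i4)%N ->
  (u i4 < u i2)%N -> (u i2 < u i3)%N -> (u i3 < u i1)%N -> False.
Proof.
move=> l12 l23 l34 v12 v23 v34.
pose v := (reflC i2 i3 * u)%g.
have vE k : v k = if k == i2 then u i3 else if k == i3 then u i2
  else if k == star i2 then star (u i3) else if k == star i3 then star (u i2) else u k.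
  by rewrite permM reflCE -!hu; do 4?[case: ifP => // _].
have hv : in_WC v by move=> k; rewrite !permM reflC_rev hu.
have [gv hgv] := rep_exists hv; have [gu hgu] := rep_exists hu.
apply: (rep_notin_schub hgv (reflC_corner hu l23 v23)).
apply/hX; split; first by case: hgv.
set z := _ *m gv.
have gz : in_gC z by apply: in_gC_conj => //; case: hgv.
have Ix : I x by split=> // g /hX[].
have hxu : invmx gu *m x *m gu \in H by case: Ix => _; apply; apply: rep_in_schub.
have us k : u (star k) = star (u k) := hu k.
(* The outer entries of the pattern and of its mirror image dominate every
   displaced point of [v]. *)
have lower (p : 'I_N) : exists r : 'I_N, [/\ (p <= r)%N, (u r <= v p)%N &
    r = i4 \/ r = star i1 \/ r = p /\ p != i1 /\ p != star i4].
  rewrite vE; case: eqVneq => [->|_]; first by exists i4; split; [lia|lia|left].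
  case: eqVneq => [->|_]; first by exists i4; split; [lia|lia|left].
  case: eqVneq => [->|_]; first by exists (star i1); rewrite us /=; split; [lia|lia|right; left].
  case: eqVneq => [->|_]; first by exists (star i1); rewrite us /=; split; [lia|lia|right; left].
  case: (eqVneq p i1) => [->|n1]; first by exists i4; split; [lia|lia|left].
  case: (eqVneq p (star i4)) => [->|n4]; last by exists p; split=> //; right; right.
  by exists (star i1); rewrite !us /=; split; [lia|lia|right; left].
have upper (q : 'I_N) : exists r : 'I_N, [/\ (r <= q)%N, (v q <= u r)%N &
    r = i1 \/ r = star i4 \/ r = q /\ q != i4 /\ q != star i1].
  rewrite vE; case: eqVneq => [->|_]; first by exists i1; split; [lia|lia|left].
  case: eqVneq => [->|_]; first by exists i1; split; [lia|lia|left].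
  case: eqVneq => [->|_]; first by exists (star i4); rewrite us /=; split; [lia|lia|right; left].
  case: eqVneq => [->|_]; first by exists (star i4); rewrite us /=; split; [lia|lia|right; left].
  case: (eqVneq q i4) => [->|n1]; first by exists i1; split; [lia|lia|left].
  case: (eqVneq q (star i1)) => [->|n4]; last by exists q; split=> //; right; right.
  by exists (star i4); rewrite !us /=; split; [lia|lia|right; left].
(* Monotonicity in [I] leads from [(v p, v q)] to [(u r, u r')], conjugation by [u] to [(r, r')] in
   [H], and monotonicity in [H] to [(p, q)]. The exclusions in [lower] and [upper] keep [r] and [r']
   distinct. *)
have root_mem p q : p != q -> supp I (v p) (v q) -> rootv p q \in H.
  move=> pq xpq; have [r [pr ur hr]] := lower p; have [r' [qr' ur' hr']] := upper q.
  have rr' : r != r'.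
    have n14 : i4 != i1 by apply: contraTneq l34 => ->; lia.
    case: hr => [->|[->|[-> [p1 p4]]]]; case: hr' => [->|[->|[-> [q1 q4]]]] //;
      rewrite ?rev_neq 1?eq_sym ?rev_neq // ?(inj_eq rev_ord_inj) //.
  apply: hess_rootv => //.
  have HgC y : y \in H -> in_gC y by case: hH => h _; apply: h.
  have Hlie (p0 q0 : 'I_N) y : (p0 < q0)%N -> y \in H -> lie (rootv p0 q0) y \in H.
    by move=> h; apply: hess_lie => //; apply: ltnW.
  apply: (supp_mono HgC Hlie (a := r) (b := r')) => //; apply: supp_rep.
  apply: (supp_mono I_gC I_lie (a := v p) (b := v q)) => //; rewrite ?(inj_eq perm_inj) //.
have off : z - diag_part z \in H.
  apply: off_diag_mem => // a b ab; rewrite (rep_conjE _ _ _ hgv) => zab; apply: root_mem => //.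
  by exists x => //; apply: contraNneq zab => ->; rewrite !mul0r.
rewrite -[z](subrK (diag_part z)) memvD //.
have zuu := diag_part_mem hH hxu; set zu := _ *m gu in zuu.
have xs k : x (star k) (star k) = - x k k.
  by have /in_gCP h := gx; rewrite h !rev_ordK -[in RHS](mul1r (x k k)) eps_rev mulrNN eps_sq mulNr.
pose kp := x (u i3) (u i3) - x (u i2) (u i2).
have zd (g : M) (s : 'S_N) i : rep_of s g -> (invmx g *m x *m g) i i = x (s i) (s i).
  by move=> hg; rewrite (rep_conjE _ _ _ hg) mulfK //; case: hg => _ ->.
(* If [i3 = star i2], then [rootv i3 i3 = - rootv i2 i2] and the difference on the right is doubled,
   hence the division by 2. *)
have dE : diag_part z - diag_part zu =
    (if i3 == star i2 then kp / 2%:R else kp) *: (rootv i2 i2 - rootv i3 i3).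
  apply/matrixP=> i j; have sub (A B : M) : (A - B) i j = A i j - B i j by rewrite !mxE.
  have -> : (diag_part z - diag_part zu) i j = (x (v i) (v i) - x (u i) (u i)) *+ (i == j).
    rewrite sub [diag_part z i j]mxE [diag_part zu i j]mxE.
    by case: eqP => [<-|_]; rewrite ?subrr // !mulr1n /z /zu (zd _ _ _ hgv) (zd _ _ _ hgu).
  have -> (c : C) : (c *: (rootv i2 i2 - rootv i3 i3)) i j =
    c * ((i == i2)%:R - (i == star i2)%:R - ((i == i3)%:R - (i == star i3)%:R)) *+ (i == j).
    have dd k : ((i == k) && (j == k))%:R = (i == k)%:R *+ (i == j) :> C.
      by case: (eqVneq i k) => [->|]; rewrite ?mul0rn // eq_sym.
    have -> : (c *: (rootv i2 i2 - rootv i3 i3)) i j = c * (rootv i2 i2 i j - rootv i3 i3 i j).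
      by rewrite -sub [LHS]mxE.
    by rewrite !rootvE !eps_sq !mul1r !dd -!mulrnBl mulrnAr.
  congr (_ *+ _); rewrite vE.
  have n23 : i2 == i3 = false by apply/negbTE; apply: contraTneq l23 => ->; rewrite ltnn.
  have rn k : k == star k = false by rewrite eq_sym; apply/negbTE/rev_neq.
  have [e|ne] := eqVneq i3 (star i2).
    have -> : star i3 = i2 by rewrite e rev_ordK.
    rewrite -e; case: (eqVneq i i2) => [->|i2n].
      by rewrite n23 /= /kp; field.
    case: (eqVneq i i3) => [->|i3n]; last by rewrite !subrr mulr0.
    by rewrite /= /kp; field.
  have ne' : i2 == star i3 = false by rewrite eq_sym (can2_eq rev_ordK rev_ordK) (negPf ne).
  case: (eqVneq i i2) => [->|i2n].
    by rewrite n23 rn ne' /= /kp; ring.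
  case: (eqVneq i i3) => [->|i3n].
    by rewrite (negPf ne) rn /= /kp; ring.
  case: (eqVneq i (star i2)) => [->|i2s].
    by rewrite us !xs (inj_eq rev_ord_inj) n23 /= /kp; ring.
  case: (eqVneq i (star i3)) => [->|i3s]; last by rewrite !subrr mulr0.
  by rewrite us !xs /= /kp; ring.
rewrite -[diag_part z](subrK (diag_part zu)) memvD // dE.
(* If [kp] is nonzero, [x] has distinct diagonal entries at [u i2 = v i3] and [u i3 = v i2]. So [I]
   has this root in its support, [rootv i3 i2] lies in [H], and so does the coroot. *)
have [k0|k0] := eqVneq kp 0; first by case: ifP; rewrite k0 ?mul0r scale0r mem0v.
rewrite memvZ // coroot_mem //; apply: root_mem.
  by apply: contraTneq l23 => ->; rewrite ltnn.
rewrite !vE !eqxx; case: eqVneq => [e|_]; first by rewrite e ltnn in l23.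
apply: (supp_diag I_lie Ix) => //.
by rewrite eq_sym -subr_eq0.
Qed.

End Main.

End Symplectic.

Theorem theorem1p11 (R : realType) (n : nat) (w : 'S_(n + n)) :
  in_WC w ->
  (exists (x : 'M[R[i]]_(n + n)) (H : {vspace 'M[R[i]]_(n + n)}),
      in_gC x /\ hessenbergC H /\
      (forall g, hessC_pre x H g <-> schubC_pre (w^-1)%g g)) ->
  avoids_pattern w [:: 4; 2; 3; 1]%N.
Proof.
move=> hw [x [H [gx [hH hX]]]] [f [fm fw]].
have hu : in_WC (w^-1)%g by move=> i; apply: (@perm_inj _ w); rewrite hw !permKV.
pose o k (lt : (k < 4)%N) : 'I_4 := Ordinal lt.
(* Positions in the inverse of [w] are values of [w], so the occurrence is listed by increasing
   value: indices 3, 1, 2, 0. The result is again a [4231]. *)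
pose p1 := w (f (o 3 isT)); pose p2 := w (f (o 1 isT)).
pose p3 := w (f (o 2 isT)); pose p4 := w (f (o 0 isT)).
apply: (no_4231 hu gx hH hX (i1 := p1) (i2 := p2) (i3 := p3) (i4 := p4));
  rewrite ?permK ?fm // /p1 /p2 /p3 /p4 fw //.
Qed.
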